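(* Let $R$ be a $J$-regular ring with Jacobson radical $J$. Then $R$ is right FP-injective if and only if $R$ is right $(J,R)$-FP-injective.
   Context: Rings are associative with identity, not necessarily commutative. $J=J(R)$ denotes the Jacobson radical of $R$. A ring $R$ is called $J$-regular if $R/J(R)$ is von Neumann regular. $R_R$ denotes $R$ as a right module over itself. A ring $R$ is right FP-injective if every homomorphism from a finitely generated submodule of a free right $R$-module $F_R$ to $R_R$ can be extended to a homomorphism from $F_R$ to $R_R$. For a set $U$ and $n\geq 1$, $U_n$ denotes the set of all $n\times 1$ matrices with entries in $U$; $R_n$ is thus a free right $R$-module of rank $n$. For right ideals $I,K$ of $R$, the ring $R$ is right $(I,K)$-FP-injective if, for any $n\geq 1$ and any finitely generated right $R$-submodule $N$ of $I_n$ (regarded as a submodule of the free right $R$-module $R_n$), every homomorphism from $N$ to $K$ can be extended to a homomorphism from $R_n$ to $R_R$. *)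

(* Defs.v *)
From HB Require Import structures.
From mathcomp Require Import all_boot all_algebra generic_quotient ring_quotient.
From mathcomp Require Import boolp.

Set Implicit Arguments.
Unset Strict Implicit.
Unset Printing Implicit Defensive.

Import GRing.Theory.
Local Open Scope ring_scope.
Local Open Scope quotient_scope.

(* A right R-module is a left module over the converse ring R^c, i.e. an
   [lmodType R^c], where a *: x stands for x a.  In particular R^c^o is R as a
   right module over itself, and 'cV[R^c]_n is the right module of n x 1
   matrices over R. *)

Section JacobsonRadical.

Variable R : pzRingType.

Definition right_ideal (I : {pred R}) : Prop :=
  submod_closed (I : {pred R^c^o}).

Definition maximal_right_ideal (M : {pred R}) : Prop :=
  [/\ right_ideal M, ~ (M =i predT)
    & forall I : {pred R}, right_ideal I -> {subset M <= I} ->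
        I =i M \/ I =i predT].

Definition jacobson : {pred R} :=
  fun x => `[< forall M : {pred R}, maximal_right_ideal M -> x \in M >].

Lemma jacobsonP x :
  reflect (forall M : {pred R}, maximal_right_ideal M -> x \in M)
          (x \in jacobson).
Proof. exact: asboolP. Qed.

Lemma right_ideal0 (I : {pred R}) : right_ideal I -> 0 \in I.
Proof. by case. Qed.

Lemma right_idealD (I : {pred R}) x y :
  right_ideal I -> x \in I -> y \in I -> x + y \in I.
Proof. by case=> _ cI xI yI; have := cI 1 x y xI yI; rewrite scale1r. Qed.

Lemma right_idealMr (I : {pred R}) x r :
  right_ideal I -> x \in I -> x * r \in I.
Proof. by case=> I0 cI xI; have := cI r x 0 xI I0; rewrite addr0. Qed.

Lemma right_idealP (I : {pred R}) :
  0 \in I -> {in I &, forall x y, x + y \in I} ->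
  (forall x r, x \in I -> x * r \in I) -> right_ideal I.
Proof.
by move=> I0 ID IM; split=> // a x y xI yI; apply: ID => //; apply: IM.
Qed.

Lemma right_idealN (I : {pred R}) x : right_ideal I -> x \in I -> - x \in I.
Proof. by move=> hI xI; rewrite -mulrN1; apply: right_idealMr. Qed.

Lemma jacobson_right_ideal : right_ideal jacobson.
Proof.
apply: right_idealP.
- by apply/jacobsonP => M [hM _ _]; apply: right_ideal0.
- move=> x y /jacobsonP xJ /jacobsonP yJ; apply/jacobsonP => M mM.
  by case: (mM) => hM _ _; apply: right_idealD; [|apply: xJ|apply: yJ].
- move=> x r /jacobsonP xJ; apply/jacobsonP => M mM.
  by case: (mM) => hM _ _; apply: right_idealMr => //; apply: xJ.
Qed.

Lemma jacobson_zmod_closed : zmod_closed jacobson.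
Proof.
have hJ := jacobson_right_ideal; split=> [|x y xJ yJ]; first exact: right_ideal0.
by apply: right_idealD => //; apply: right_idealN.
Qed.

HB.instance Definition _ :=
  GRing.isZmodClosed.Build R jacobson jacobson_zmod_closed.

Lemma jacobsonMr x r : x \in jacobson -> x * r \in jacobson.
Proof. exact/right_idealMr/jacobson_right_ideal. Qed.

(* For M maximal and r \notin M, the colon ideal {y | r y \in M} is again a
   maximal right ideal. *)
Lemma jacobsonMl r x : x \in jacobson -> r * x \in jacobson.
Proof.
move=> /jacobsonP xJ; apply/jacobsonP => M mM; case: (mM) => hM _ maxM.
case: (boolP (r \in M)) => rM; first exact: right_idealMr.
pose C : {pred R} := fun y => r * y \in M.
have CE y : (y \in C) = (r * y \in M) by [].
have hC : right_ideal C.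
  apply: right_idealP => [|y z|y t]; rewrite !CE ?mulr0 ?mulrDr ?mulrA.
  - exact: right_ideal0.
  - exact: right_idealD.
  - exact: right_idealMr.
rewrite -CE; apply: xJ; split=> //.
  by move=> /(_ 1); rewrite CE mulr1 (negPf rM).
move=> I hI CI; case: (EM (exists2 y, y \in I & y \notin C)); last first.
  move=> nI; left=> y; apply/idP/idP; last exact: CI.
  by move=> yI; apply: contrapT => /negP yC; apply: nI; exists y.
case=> y yI; rewrite CE => ryM; right=> z; rewrite [RHS]inE.
pose S : {pred R} :=
  fun u => `[< exists m t, m \in M /\ u = m + r * y * t >].
have SP u : reflect (exists m t, m \in M /\ u = m + r * y * t) (u \in S).
  exact: asboolP.
have hS : right_ideal S.
  apply: right_idealP.
  - apply/SP; exists 0, 0; rewrite mulr0 addr0; split=> //.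
    exact: right_ideal0.
  - move=> u v /SP[m [t [mm ->]]] /SP[m' [t' [mm' ->]]].
    apply/SP; exists (m + m'), (t + t'); rewrite mulrDr addrACA; split=> //.
    exact: right_idealD.
  - move=> u s /SP[m [t [mm ->]]].
    apply/SP; exists (m * s), (t * s); rewrite mulrDl !mulrA; split=> //.
    exact: right_idealMr.
have MS : {subset M <= S}.
  by move=> m mm; apply/SP; exists m, 0; rewrite mulr0 addr0.
case: (maxM S hS MS) => SE.
  case/negP: ryM; rewrite -SE; apply/SP; exists 0, 1.
  by rewrite mulr1 add0r; split=> //; apply: right_ideal0.
have /SP[m [t [mm rz]]] : r * z \in S by rewrite SE.
rewrite -[z](subrK (y * t)); apply: right_idealD => //; last first.
  exact: right_idealMr.
by apply: CI; rewrite CE mulrBr rz mulrA addrK.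
Qed.

(* The quotient ring R / J(R): the quotient Z-module of the library, equipped
   with the induced multiplication (the library only provides the latter for
   commutative rings). *)
Definition quotJ : Type := Quotient.quot jacobson.

HB.instance Definition _ := GRing.Zmodule.on quotJ.
HB.instance Definition _ := EqQuotient.on quotJ.

Lemma quotJ_eqE x y : (x == y %[mod quotJ]) = (x - y \in jacobson).
Proof. by rewrite Quotient.idealrBE. Qed.

Definition quotJ_one : quotJ := \pi_quotJ 1.
Definition quotJ_mul := lift_op2 quotJ *%R.

Lemma pi_quotJM x y :
  \pi_quotJ (x * y) = quotJ_mul (\pi_quotJ x) (\pi_quotJ y).
Proof.
unlock quotJ_mul; apply/eqP; rewrite quotJ_eqE.
set x' := repr (\pi_quotJ x); set y' := repr (\pi_quotJ y).
have xx' : x - x' \in jacobson by rewrite -quotJ_eqE reprK.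
have yy' : y - y' \in jacobson by rewrite -quotJ_eqE reprK.
have -> : x * y - x' * y' = (x - x') * y + x' * (y - y').
  by rewrite mulrBl mulrBr addrA subrK.
by apply: rpredD; [exact: jacobsonMr | exact: jacobsonMl].
Qed.

Lemma pi_quotJD x y : \pi_quotJ (x + y) = \pi_quotJ x + \pi_quotJ y :> quotJ.
Proof. exact: (@pi_addr R _ _ _ _ (Quotient.quot jacobson)). Qed.

Lemma quotJ_mulA : associative quotJ_mul.
Proof.
elim/quotW=> x; elim/quotW=> y; elim/quotW=> z.
by rewrite -(pi_quotJM y z) -(pi_quotJM x y) -!pi_quotJM mulrA.
Qed.

Lemma quotJ_mul1 : left_id quotJ_one quotJ_mul.
Proof. by elim/quotW=> x; rewrite -pi_quotJM mul1r. Qed.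

Lemma quotJ_mulr1 : right_id quotJ_one quotJ_mul.
Proof. by elim/quotW=> x; rewrite -pi_quotJM mulr1. Qed.

Lemma quotJ_mulDl : left_distributive quotJ_mul +%R.
Proof.
elim/quotW=> x; elim/quotW=> y; elim/quotW=> z.
by rewrite -pi_quotJD -!pi_quotJM mulrDl pi_quotJD.
Qed.

Lemma quotJ_mulDr : right_distributive quotJ_mul +%R.
Proof.
elim/quotW=> x; elim/quotW=> y; elim/quotW=> z.
by rewrite -pi_quotJD -!pi_quotJM mulrDr pi_quotJD.
Qed.

HB.instance Definition _ := GRing.Zmodule_isPzRing.Build quotJ
  quotJ_mulA quotJ_mul1 quotJ_mulr1 quotJ_mulDl quotJ_mulDr.

End JacobsonRadical.

Definition von_neumann_regular (R : pzRingType) : Prop :=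
  forall a : R, exists b : R, a = a * b * a.

Definition J_regular (R : pzRingType) : Prop := von_neumann_regular (quotJ R).

Definition finitely_generated (R : pzRingType) (M : lmodType R) : Prop :=
  exists m (g : 'I_m -> M), forall x, exists c : 'I_m -> R,
    x = \sum_i c i *: g i.

(* B may be infinite: linear combinations are taken along finite lists of
   elements of B, without repetition in the independence clause. *)
Definition is_basis (R : pzRingType) (M : lmodType R) (B : M -> Prop) : Prop :=
  (forall x, exists (s : seq M) (c : M -> R),
      {in s, forall b, B b} /\ x = \sum_(b <- s) c b *: b) /\
  (forall (s : seq M) (c : M -> R), uniq s -> {in s, forall b, B b} ->
      \sum_(b <- s) c b *: b = 0 -> {in s, forall b, c b = 0}).

Definition free_module (R : pzRingType) (M : lmodType R) : Prop :=
  exists B : M -> Prop, is_basis B.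

(* [N : subLmodType S] ranges over the submodules of F (S being the carrier of
   N as a subset of F, and \val the inclusion); boolean membership is no
   restriction under the axioms of boolp. *)
Definition right_FP_injective (R : pzRingType) : Prop :=
  forall F : lmodType R^c, free_module F ->
  forall (S : {pred F}) (N : subLmodType S), finitely_generated N ->
  forall f : {linear N -> R^c^o},
    exists g : {linear F -> R^c^o}, forall u : N, g (\val u) = f u.

(* Meant for right ideals I and K; a homomorphism from N to K is one from N to R
   with values in K. *)
Definition right_IK_FP_injective (R : pzRingType) (I K : {pred R}) : Prop :=
  forall n, (0 < n)%N ->
  forall (S : {pred 'cV[R^c]_n}) (N : subLmodType S),
    (forall x, x \in S -> forall i, x i 0 \in I) -> finitely_generated N ->
  forall f : {linear N -> R^c^o}, (forall u, f u \in K) ->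
    exists g : {linear 'cV[R^c]_n -> R^c^o}, forall u : N, g (\val u) = f u.

(* Main.v *)
Require Import Defs.
From HB Require Import structures.
From mathcomp Require Import all_boot all_algebra generic_quotient.
From mathcomp Require Import boolp.
Set Implicit Arguments.
Unset Strict Implicit.
Unset Printing Implicit Defensive.
Import GRing.Theory.
Local Open Scope ring_scope.

(** One direction is immediate, since the modules [R_n] are free.

For the other one, a homomorphism from a finitely generated submodule [N] to
[R] amounts to a family of generators of [N] together with the list [r] of
their images, subject to: every linear relation between the generators is one
between the images ([extension_property]).  Finitely many elements of a free
module only involve finitely many basis vectors, so that the coordinates along
these reduce the problem to [R_n] ([free_finite_coordinates]); there the
generators are the columns of a matrix [A], a relation is a column [c] with
[A c = 0], and the problem is to find a row [h] with [h A = r].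

Rectangular matrices over a von Neumann regular ring are regular
([regular_matrix]).  Applied to [R / J], this yields a matrix [B] such that
[K = A - A B A] has all its entries in [J] ([J_regular_mx]).  The relations
between the columns of [K = A (1 - B A)] are relations between those of
[t = r (1 - B A)], so the hypothesis on submodules of [J_n] yields a row [h0]
with [h0 K = t].  Then [h = r B + h0 (1 - A B)] is the required row, as
[h A = r B A + h0 K = r].

In module terms, [A B] is an endomorphism of [R_n] with image in [N] that is
the identity on [N] modulo [J_n].  The given homomorphism is thus defined on
the image of [A B], and only its restriction to the submodule [(1 - A B) N] of
[J_n] has to be extended. *)

(** * Regularity of matrices over a von Neumann regular ring *)

Definition regular_mx (R : pzRingType) m n (A : 'M[R]_(m, n)) : Prop :=
  exists B, A = A *m B *m A.

(** Once the columns of [A] are split off by the idempotent [A B], only the part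
of [X] outside of its image remains: the idempotent [P] for the row block
matrix is given by [1 - P = (1 - Y C) (1 - A B)] with
[Y = (1 - A B) X = Y C Y]. *)
Lemma regular_row_mx (R : pzRingType) m n1 n2
    (A : 'M[R]_(m, n1)) (X : 'M[R]_(m, n2)) B :
  A = A *m B *m A -> regular_mx (X - A *m B *m X) ->
  regular_mx (row_mx A X).
Proof.
move=> AB; move YE: (X - A *m B *m X) => Y [C YC].
pose D := C *m (1%:M - A *m B).
exists (col_mx (B - B *m X *m D) D).
have -> : row_mx A X *m col_mx (B - B *m X *m D) D = A *m B + Y *m D.
  by rewrite mul_row_col -YE mulmxBr mulmxBl !mulmxA -addrA [- _ + _]addrC.
have AB0 : (1%:M - A *m B) *m A = 0 by rewrite mulmxBl mul1mx -AB subrr.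
rewrite mul_mx_row !mulmxDl -!(mulmxA Y) -!(mulmxA C) AB0 !mulmx0 addr0 -AB.
by rewrite mulmxBl mul1mx YE mulmxA -YC -YE addrC subrK.
Qed.

(** Turns the treatment of row blocks into one of column blocks, regularity of a
ring being left-right symmetric. *)
Lemma regular_tr (R : pzRingType) m n (A : 'M[R]_(m, n)) :
  @regular_mx R^c n m A^T -> regular_mx A.
Proof.
case=> B AB; exists (B : 'M[R]_(m, n))^T; apply: trmx_inj.
rewrite [RHS](trmx_mul_rev (A *m _) A) [X in mulmx _ X](trmx_mul_rev A _).
by rewrite trmxK mulmxA.
Qed.

Lemma regular_rV (R : pzRingType) n (A : 'rV[R]_n) :
  von_neumann_regular R -> regular_mx A.
Proof.
move=> regR; elim: n A => [|n IHn] A; first by exists 0; apply/matrixP=> i [].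
rewrite -[n.+1]/(1 + n)%N in A *.
rewrite -[A]hsubmxK.
have [b Ab] := regR (lsubmx A 0 0).
apply: (@regular_row_mx _ _ _ _ _ _ b%:M); last exact: IHn.
by rewrite [lsubmx A]mx11_scalar -!scalar_mxM -Ab.
Qed.

Lemma von_neumann_regular_conv (R : pzRingType) :
  von_neumann_regular R -> von_neumann_regular R^c.
Proof.
by move=> regR a; have [b ab] := regR a; exists b; rewrite {1}ab -mulrA.
Qed.

Lemma regular_matrix (R : pzRingType) m n (A : 'M[R]_(m, n)) :
  von_neumann_regular R -> regular_mx A.
Proof.
move=> regR; elim: n A => [|n IHn] A; first by exists 0; apply/matrixP=> i [].
rewrite -[n.+1]/(1 + n)%N in A *; rewrite -[A]hsubmxK.
have regC (C : 'cV[R]_m) : regular_mx C.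
  by apply/regular_tr/regular_rV/von_neumann_regular_conv.
have [B AB] := regC (lsubmx A).
exact: (regular_row_mx AB).
Qed.

(** * Lifting regularity from the quotient by the Jacobson radical *)

Definition pi_J (R : pzRingType) (x : R) : quotJ R := \pi_(quotJ R)%qT x.

Lemma pi_J_zmod_morphism (R : pzRingType) : zmod_morphism (@pi_J R).
Proof.
move=> x y; rewrite /pi_J; apply: (@addIr _ (\pi_(quotJ R)%qT y)).
by rewrite -pi_quotJD !subrK.
Qed.

Lemma pi_J_monoid_morphism (R : pzRingType) : monoid_morphism (@pi_J R).
Proof. by split=> // x y; apply: pi_quotJM. Qed.

HB.instance Definition _ (R : pzRingType) :=
  GRing.isZmodMorphism.Build R (quotJ R) (@pi_J R) (@pi_J_zmod_morphism R).
HB.instance Definition _ (R : pzRingType) :=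
  GRing.isMonoidMorphism.Build R (quotJ R) (@pi_J R) (@pi_J_monoid_morphism R).

Lemma pi_J_eq0 (R : pzRingType) (x : R) : pi_J x = 0 -> x \in @jacobson R.
Proof.
move=> x0; rewrite -[x]subr0 -quotJ_eqE; apply/eqP.
by rewrite -/(pi_J x) x0 -(raddf0 (@pi_J R)).
Qed.

Lemma J_regular_mx (R : pzRingType) n m (A : 'M[R]_(n, m)) :
  J_regular R -> exists B, forall i j, (A - A *m B *m A) i j \in @jacobson R.
Proof.
move=> regR; have [B AB] := regular_matrix (map_mx (@pi_J R) A) regR.
have BK : map_mx (@pi_J R) (map_mx (fun q : quotJ R => repr q) B) = B.
  by apply/matrixP=> i j; rewrite !mxE; apply: reprK.
exists (map_mx (fun q : quotJ R => repr q) B) => i j; apply: pi_J_eq0.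
by have := congr1 (fun M : 'M_(n, m) => M i j) (map_mxB (@pi_J R) A
    (A *m map_mx (fun q : quotJ R => repr q) B *m A));
   rewrite !map_mxM BK -AB subrr !mxE.
Qed.

(** * Homomorphisms from finitely generated submodules *)

(** A family [r] satisfying the premise is the same thing as a homomorphism to
the ring from the submodule generated by [g], sending [g i] to [r i]. *)
Definition extension_property (R : pzRingType) (V : lmodType R) m
    (g : 'I_m -> V) : Prop :=
  forall r : 'I_m -> R^o,
  (forall c : 'I_m -> R, \sum_i c i *: g i = 0 -> \sum_i c i *: r i = 0) ->
  exists h : {linear V -> R^o}, forall i, h (g i) = r i.

Lemma linear_bundle (R : pzRingType) (V W : lmodType R) (f : V -> W) :
  linear f -> exists h : {linear V -> W}, h =1 f.
Proof.
move=> lf; pose m := GRing.isLinear.Build R V W _ f lf.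
pose h : {linear V -> W} := HB.pack f m.
by exists h.
Qed.

Lemma extend_of_generators (R : pzRingType) (F : lmodType R) (S : {pred F})
    (N : subLmodType S) :
  (forall m (g : 'I_m -> F), extension_property g) -> finitely_generated N ->
  forall f : {linear N -> R^o},
    exists h : {linear F -> R^o}, forall u : N, h (\val u) = f u.
Proof.
move=> ext [m [g gen]] f.
have [c c0|h hg] := ext m (fun i => \val (g i)) (fun i => f (g i)).
  under eq_bigr do rewrite -linearZ.
  rewrite -linear_sum /=; suff -> : \sum_i c i *: g i = 0 by rewrite linear0.
  apply: val_inj; rewrite linear_sum linear0 -[RHS]c0.
  by apply: eq_bigr => i _; rewrite linearZ.
exists h => u; have [c ->] := gen u; rewrite !linear_sum.
by apply: eq_bigr => i _; rewrite !linearZ /= hg.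
Qed.

Definition spanned (R : pzRingType) (V : lmodType R) m (g : 'I_m -> V) :
    {pred V} := fun x => `[< exists c : 'I_m -> R, x = \sum_i c i *: g i >].

Lemma spannedP (R : pzRingType) (V : lmodType R) m (g : 'I_m -> V) x :
  reflect (exists c : 'I_m -> R, x = \sum_i c i *: g i) (x \in spanned g).
Proof. exact: asboolP. Qed.

Lemma spanned_subsemimod_closed (R : pzRingType) (V : lmodType R) m
  (g : 'I_m -> V) : GRing.subsemimod_closed (spanned g).
Proof.
split; first split.
- apply/spannedP; exists (fun=> 0).
  by under eq_bigr do rewrite scale0r; rewrite big1.
- move=> x y /spannedP[c ->] /spannedP[d ->]; apply/spannedP.
  exists (fun i => c i + d i).
  by under [RHS]eq_bigr do rewrite scalerDl; rewrite big_split.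
- move=> a x /spannedP[c ->]; apply/spannedP; exists (fun i => a * c i).
  by rewrite scaler_sumr; apply: eq_bigr => i _; rewrite scalerA.
Qed.

(** The span of [g] as a type of its own, so that it can carry the structure of
a submodule. *)
Definition spanned_mod (R : pzRingType) (V : lmodType R) m (g : 'I_m -> V) :=
  {x | x \in spanned g}.
HB.instance Definition _ (R : pzRingType) (V : lmodType R) m (g : 'I_m -> V) :=
  [isSub of spanned_mod g for @sval V (fun x => x \in spanned g)].
HB.instance Definition _ (R : pzRingType) (V : lmodType R) m (g : 'I_m -> V) :=
  [Choice of spanned_mod g by <:].
HB.instance Definition _ (R : pzRingType) (V : lmodType R) m (g : 'I_m -> V) :=
  GRing.SubChoice_isSubLmodule.Build R V (spanned g) (spanned_mod g)
    (spanned_subsemimod_closed g).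

Lemma sum_delta_scale (R : pzRingType) (V : lmodType R) m (g : 'I_m -> V) i :
  \sum_j (j == i)%:R *: g j = g i.
Proof.
rewrite (bigD1 i) //= eqxx scale1r big1 ?addr0 // => j /negPf->.
exact: scale0r.
Qed.

(** The converse passage, from the submodule to its generators: a family [r]
that respects the relations between the [g i] defines a homomorphism on their
span, by choosing for each vector a combination of the [g i]. *)
Lemma extension_property_spanned (R : pzRingType) (V : lmodType R) m
    (g : 'I_m -> V) :
  (finitely_generated (spanned_mod g) ->
   forall f : {linear spanned_mod g -> R^o},
   exists h : {linear V -> R^o}, forall u, h (\val u) = f u) ->
  extension_property g.
Proof.
move=> ext r rel.
have gS i : g i \in spanned g.
  by apply/spannedP; exists (fun j => (j == i)%:R); rewrite sum_delta_scale.
pose G i : spanned_mod g := Sub (g i) (gS i).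
have gen (u : spanned_mod g) : exists c : 'I_m -> R, u = \sum_i c i *: G i.
  have /spannedP[c uc] := valP u; exists c; apply: val_inj.
  rewrite linear_sum uc; apply: eq_bigr => i _.
  by rewrite linearZ.
pose f u := \sum_i projT1 (cid (gen u)) i *: r i : R^o.
have fE u c : u = \sum_i c i *: G i -> f u = \sum_i c i *: r i.
  rewrite /f; case: cid => d /= -> /(congr1 val).
  rewrite !linear_sum => cd; apply/eqP; rewrite -subr_eq0 -sumrB; apply/eqP.
  under eq_bigr do rewrite -scalerBl.
  apply: rel; under eq_bigr do rewrite scalerBl.
  rewrite sumrB; apply/eqP; rewrite subr_eq0; apply/eqP.
  have valZ e : \sum_i \val (e i *: G i) = \sum_i e i *: g i.
    by apply: eq_bigr => i _; rewrite linearZ.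
  by rewrite -!valZ.
have lf : linear f.
  move=> a u v; have [c uc] := gen u; have [d vd] := gen v.
  rewrite (fE _ _ uc) (fE _ _ vd) (fE _ (fun i => a * c i + d i)).
    rewrite scaler_sumr -big_split; apply: eq_bigr => i _ /=.
    by rewrite scalerDl scalerA.
  rewrite uc vd scaler_sumr -big_split; apply: eq_bigr => i _ /=.
  by rewrite scalerDl scalerA.
have [f' ff'] := linear_bundle lf.
have [|h hf] := ext _ f'; first by exists m, G.
exists h => i; rewrite -[g i]/(\val (G i)) hf ff'.
rewrite (fE _ (fun j => (j == i)%:R)).
  exact: sum_delta_scale.
by rewrite sum_delta_scale.
Qed.

(** * Extension from submodules of the modules of columns *)

(** The core of the proof: regularity modulo [J] replaces [A] by [A - A B A],
whose entries are in [J]. *)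
Lemma extension_mx (R : pzRingType) n m (A : 'M[R]_(n, m)) (r : 'rV[R]_m) :
  J_regular R ->
  (forall (K : 'M[R]_(n, m)) (t : 'rV[R]_m),
     (forall i j, K i j \in @jacobson R) ->
     (forall c : 'cV[R]_m, K *m c = 0 -> t *m c = 0) ->
     exists h, h *m K = t) ->
  (forall c : 'cV[R]_m, A *m c = 0 -> r *m c = 0) ->
  exists h, h *m A = r.
Proof.
move=> regR extJ rel; have [B AJ] := J_regular_mx A regR.
have [|h0 h0K] := extJ _ (r - r *m B *m A) AJ.
  move=> c Kc0; have := rel (c - B *m A *m c).
  by rewrite !mulmxBr !mulmxA -!mulmxBl => ->.
exists (r *m B + h0 *m (1%:M - A *m B)).
by rewrite mulmxDl -(mulmxA h0) mulmxBl mul1mx h0K addrC subrK.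
Qed.

(** Over the converse ring, a combination of columns with coefficients [c] is
the product of a matrix over [R] by the column [c], and multiplication on the
left by a row over [R] is a homomorphism of right modules. *)
Lemma extension_property_cV (R : pzRingType) n m (g : 'I_m -> 'cV[R^c]_n.+1) :
  J_regular R -> right_IK_FP_injective (@jacobson R) (@predT R) ->
  extension_property g.
Proof.
move=> regR FPJ r rel.
have [|c Ac0|h hA] := @extension_mx R n.+1 m (\matrix_(i, j) g j i 0)
   (\row_j r j) regR.
- move=> K t KJ relK.
  pose colK j : 'cV[R^c]_n.+1 := col j K.
  have [||h hK] :=
    @extension_property_spanned R^c _ m colK _ (fun j => t 0 j).
  + move=> fg f.
    apply: (FPJ n.+1 _ (spanned _) (spanned_mod _) _ fg f) => // x.
    case/spannedP=> c -> i; rewrite summxE.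
    apply: (@rpred_sum R (@jacobson R)) => j _.
    by rewrite !mxE; apply: jacobsonMr.
  + move=> c Kc0; have := relK (\col_j c j).
    move=> /(_ _)/matrixP-/(_ _ 0 0); rewrite !mxE => E.
    rewrite -[RHS]E; first by apply: eq_bigr => j _; rewrite !mxE.
    apply/matrixP=> i k; rewrite -Kc0 !(mxE, summxE).
    by apply: eq_bigr => j _; rewrite !mxE.
  exists (\row_i h (delta_mx i 0)); apply/rowP=> j; rewrite -hK mxE.
  rewrite [in RHS](matrix_sum_delta (colK j)) linear_sum.
  by apply: eq_bigr => i _; rewrite big_ord1 linearZ !mxE.
- apply/matrixP=> i k; rewrite !mxE !ord1.
  rewrite -[RHS](rel (fun j => c j 0)).
    by apply: eq_bigr => j _; rewrite mxE.
  apply/matrixP=> l k'; have := congr1 (fun M : 'cV_n.+1 => M l 0) Ac0.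
  rewrite !mxE !ord1; apply: etrans; rewrite summxE.
  by apply: eq_bigr => j _; rewrite !mxE.
have lh : linear (fun x : 'cV[R^c]_n.+1 =>
    (h *m (x : 'cV[R]_n.+1)) 0 0 : R^c^o).
  move=> a x y; rewrite !mxE scaler_sumr -big_split; apply: eq_bigr => i _ /=.
  rewrite !mxE; apply: (etrans (@mulrDr R _ _ _)).
  exact: (congr1 (fun z : R => z + h 0 i * y i 0) (@mulrA R _ _ _)).
have [h' hh'] := linear_bundle lh.
exists h' => j.
have <- : (h *m \matrix_(i, j) g j i 0) 0 j = r j by rewrite hA mxE.
by rewrite hh' !mxE; apply: eq_bigr => i _; rewrite mxE.
Qed.

(** * Coordinates in a free module *)

Lemma big_widen_support (V : nmodType) (T : eqType) (s t : seq T) (w : T -> V) :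
  uniq s -> uniq t -> {subset s <= t} ->
  (forall b, b \notin s -> w b = 0) ->
  \sum_(b <- t) w b = \sum_(b <- s) w b.
Proof.
move=> us ut st w0; rewrite (bigID (mem s)) /= [X in _ + X]big1 ?addr0 //.
rewrite -big_filter; apply/perm_big/uniq_perm; rewrite ?filter_uniq // => b.
by rewrite mem_filter andb_idr //; apply: st.
Qed.

(** The universal property of a free module.  An expansion of a vector is a
duplicate-free list of basis vectors and coefficients that vanish outside of
it, so that several expansions can be summed along a common list; independence
of the basis then gives both uniqueness and linearity. *)
Lemma basis_linear_extension (R : pzRingType) (F M : lmodType R)
    (B : F -> Prop) (v : F -> M) :
  is_basis B -> exists L : {linear F -> M}, forall b, B b -> L b = v b.
Proof.
case=> gen free.
pose expansion x (s : seq F) (c : F -> R) :=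
  [/\ uniq s, {in s, forall b, B b}, forall b, b \notin s -> c b = 0
    & x = \sum_(b <- s) c b *: b].
have exp_ex x : exists sc, expansion x sc.1 sc.2.
  have [s [c [sB ->]]] := gen x.
  (* Repetitions in [s] are absorbed in the coefficients. *)
  exists (undup s, fun b => c b *+ count_mem b s); split=> /=.
  - exact: undup_uniq.
  - by move=> b; rewrite mem_undup; apply: sB.
  - by move=> b; rewrite mem_undup => /count_memPn->.
  - rewrite -big_undup_iterop_count.
    by apply: eq_bigr => b _; rewrite -scalerMnl.
pose L x := let sc := projT1 (cid (exp_ex x)) in
  \sum_(b <- sc.1) sc.2 b *: v b.
have expand0 s c : uniq s -> {in s, forall b, B b} ->
    \sum_(b <- s) c b *: b = 0 -> \sum_(b <- s) c b *: v b = 0.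
  move=> us sB c0; rewrite big_seq big1 // => b bs.
  by rewrite (free s c us sB c0 b bs) scale0r.
have Llin a x y s t u c d e : expansion x s c -> expansion y t d ->
    expansion (a *: x + y) u e ->
  \sum_(b <- u) e b *: v b =
    a *: (\sum_(b <- s) c b *: v b) + \sum_(b <- t) d b *: v b.
  move=> [us sB c0 xE] [ut tB d0 yE] [uu uB e0 zE].
  pose w := undup (s ++ t ++ u).
  have uw : uniq w by apply: undup_uniq.
  have wB : {in w, forall b, B b}.
    by move=> b; rewrite mem_undup !mem_cat => /or3P[/sB|/tB|/uB].
  have widen (k : seq F) (f : F -> R) (V : lmodType R) (p : F -> V) :
      uniq k -> {subset k <= w} -> (forall b, b \notin k -> f b = 0) ->
      \sum_(b <- k) f b *: p b = \sum_(b <- w) f b *: p b.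
    move=> uk kw f0; rewrite (big_widen_support uk uw kw) // => b bk.
    by rewrite f0 // scale0r.
  have sw : {subset s <= w} by move=> b; rewrite mem_undup !mem_cat => ->.
  have tw : {subset t <= w}.
    by move=> b; rewrite mem_undup !mem_cat => ->; rewrite orbT.
  have uw' : {subset u <= w}.
    by move=> b; rewrite mem_undup !mem_cat => ->; rewrite !orbT.
  have comb (V : lmodType R) (p : F -> V) :
      \sum_(b <- w) (a * c b + d b - e b) *: p b =
      a *: (\sum_(b <- s) c b *: p b) + \sum_(b <- t) d b *: p b
      - \sum_(b <- u) e b *: p b.
    rewrite (widen s) // (widen t) // (widen u) // scaler_sumr -big_split.
    rewrite -sumrB; apply: eq_bigr => b _ /=.
    by rewrite scalerBl scalerDl scalerA.
  apply/esym/eqP; rewrite -subr_eq0 -comb; apply/eqP/expand0 => //.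
  by rewrite comb -xE -yE -zE subrr.
have lL : linear L.
  move=> a x y; rewrite /L; do 3!case: cid => ? ? /=.
  by apply: Llin; eassumption.
have [L' LL'] := linear_bundle lL.
exists L' => b bB; rewrite LL' /L; case: cid => -[s c] /= bE.
have b1 : expansion b [:: b] (fun x => (x == b)%:R).
  split=> //; first by move=> x; rewrite inE => /eqP->.
    by move=> x; rewrite inE => /negPf->.
  by rewrite big_seq1 eqxx scale1r.
have zz : expansion 0 [::] (fun=> 0) by split=> //; rewrite big_nil.
rewrite -[b in expansion b s c](addr0 b) -[b in b + _]scale1r in bE.
by rewrite (Llin _ _ _ _ _ _ _ _ _ b1 zz bE) big_nil big_seq1 eqxx !scale1r
           addr0.
Qed.

(** Only the basis vectors occurring in chosen expansions of the [g i] matter: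
[p] reads the coordinates along them and [q] recombines these. *)
Lemma free_finite_coordinates (R : pzRingType) (F : lmodType R) m
    (g : 'I_m -> F) : free_module F ->
  exists n (p : {linear F -> 'cV[R]_n.+1}) (q : {linear 'cV[R]_n.+1 -> F}),
    forall i, q (p (g i)) = g i.
Proof.
case=> B bB; have gen := bB.1.
have {gen}/boolp.choice[e eP] i : exists e : seq F * (F -> R),
    {in e.1, forall b, B b} /\ g i = \sum_(b <- e.1) e.2 b *: b.
  by have [s [c sc]] := gen (g i); exists (s, c).
pose s := flatten [seq (e i).1 | i <- enum 'I_m].
(* The extra last coordinate, where the default value 0 of nth is read, receives
   the basis vectors outside of [s]; a vector repeated in [s] is sent to its
   first position only. *)
have lq : linear (fun u : 'cV[R]_(size s).+1 => \sum_i u i 0 *: s`_i).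
  move=> a u v; rewrite scaler_sumr -big_split; apply: eq_bigr => i _ /=.
  by rewrite !mxE scalerDl scalerA.
have [q qE] := linear_bundle lq.
have [p pE] := basis_linear_extension
  (fun b => delta_mx (inord (index b s)) 0 : 'cV[R]_(size s).+1) bB.
exists (size s), p, q => i; have [eB {2}->] := eP i.
rewrite {1}(eP i).2 !linear_sum big_seq [RHS]big_seq.
apply: eq_bigr => b be; rewrite !linearZ /= pE; last exact: eB.
have bs : b \in s.
  by apply/flattenP; exists (e i).1 => //; apply: map_f; rewrite mem_enum.
have si : (index b s < (size s).+1)%N by rewrite ltnS index_size.
congr (_ *: _); rewrite qE (bigD1 (inord (index b s))) //= mxE !eqxx scale1r.
rewrite inordK // nth_index // big1 ?addr0 // => j /negPf jb.
by rewrite mxE jb scale0r.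
Qed.

Lemma free_module_cV (R : pzRingType) n : free_module 'cV[R]_n.
Proof.
exists (fun b => exists i, b = delta_mx i 0); split.
- move=> x; exists [seq delta_mx i 0 | i <- enum 'I_n].
  (* This scalar product is the coefficient x i 0 when b = delta_mx i 0. *)
  exists (fun b : 'cV[R]_n => \sum_i b i 0 * x i 0); split.
    by move=> _ /mapP[i _ ->]; exists i.
  rewrite big_map enumT {1}(matrix_sum_delta x); apply: eq_bigr => i _.
  rewrite big_ord1; congr (_ *: _); rewrite (bigD1 i) //= mxE !eqxx mul1r.
  by rewrite big1 ?addr0 // => j /negPf ji; rewrite mxE ji mul0r.
- move=> s c us sB c0 b bs; have [i bi] := sB b bs.
  have /matrixP/(_ i 0) := c0; rewrite summxE (bigD1_seq b) //= mxE.
  rewrite {2}bi !mxE !eqxx mulr1 big_seq_cond big1 ?addr0 // => d /andP[ds db].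
  have [j dj] := sB d ds; rewrite mxE dj mxE.
  case: eqVneq => [ij|_]; last by rewrite mulr0.
  by rewrite dj bi ij eqxx in db.
Qed.

Theorem theorem15 (R : pzRingType) :
  J_regular R ->
  (right_FP_injective R <-> right_IK_FP_injective (@jacobson R) (@predT R)).
Proof.
move=> regR; split=> [FP n _ S N _ fgN f _ | FPJ F freeF S N].
  exact: (FP _ (@free_module_cV R^c n)).
apply: extend_of_generators => m g r rel.
have [n [p [q qp]]] := free_finite_coordinates g freeF.
have [c c0|h hE] := @extension_property_cV R n m (fun i => p (g i)) regR FPJ r.
  apply: rel; have := congr1 q c0; rewrite linear0 linear_sum; apply: etrans.
  by apply: eq_bigr => i _; rewrite linearZ /= qp.
by exists (h \o p)%FUN => i /=; apply: hE.
Qed.
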